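(* Let $X$ be a metrizable space. Then the free locally convex space $L(X)$ has a $\mathfrak{G}$-base if and only if $X$ is $\sigma$-compact.
   Context: $\mathbb{N}^{\mathbb{N}}$ is ordered coordinatewise: $\alpha\le\beta$ iff $\alpha(n)\le\beta(n)$ for all $n\in\mathbb{N}$. $\mathfrak{G}$-base: a topological space $Z$ has a $\mathfrak{G}$-base at $z\in Z$ if it has a base $\{U_\alpha:\alpha\in\mathbb{N}^{\mathbb{N}}\}$ of neighborhoods at $z$ such that $U_\beta\subseteq U_\alpha$ whenever $\alpha\le\beta$; $Z$ has a $\mathfrak{G}$-base if it has one at each of its points. Free locally convex space: $L(X)$ is a (real, Hausdorff) locally convex space together with a continuous map $i:X\to L(X)$ such that for every continuous map $f$ from $X$ to a locally convex space $E$ there is a unique continuous linear operator $\bar f:L(X)\to E$ with $f=\bar f\circ i$. It exists and is unique up to isomorphism. *)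

(* Defs.v *)
From HB Require Import structures.
From mathcomp Require Import all_boot all_order all_algebra.
From mathcomp Require Import all_classical all_reals all_analysis.

Set Implicit Arguments.
Unset Strict Implicit.
Unset Printing Implicit Defensive.

Import Order.TTheory GRing.Theory Num.Theory.
Import numFieldNormedType.Exports.

Local Open Scope classical_set_scope.
Local Open Scope ring_scope.

Definition is_metric (R : realType) (X : Type) (d : X -> X -> R) : Prop :=
  [/\ forall x y, 0 <= d x y,
      forall x y, d x y = 0 <-> x = y,
      forall x y, d x y = d y x
    & forall x y z, d x z <= d x y + d y z].

Definition metrizable (R : realType) (X : topologicalType) : Prop :=
  exists2 d : X -> X -> R, is_metric d
    & forall x : X,
        nbhs x = filter_from [set e : R | 0 < e] (fun e => [set y | d x y < e]).

Definition sigma_compact (X : topologicalType) : Prop :=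
  exists2 K : nat -> set X, (forall n, compact (K n))
    & \bigcup_n K n = [set: X].

(* The sets [U a] need not be open. *)
Definition has_G_base_at (Z : topologicalType) (z : Z) : Prop :=
  exists2 U : (nat -> nat) -> set Z, nbhs z = filter_from [set: nat -> nat] U
    & forall a b : nat -> nat, (forall n, (a n <= b n)%N) -> U b `<=` U a.

Definition has_G_base (Z : topologicalType) : Prop :=
  forall z : Z, has_G_base_at z.

(* [tvsType R] is the library's type of locally convex spaces; it does not
   include separation, so Hausdorffness is required both of [L] and of the
   test spaces [E]. A [tvsType] also carries a uniformity inducing its
   topology, but only the topology is used here. *)
Definition is_free_lcs (R : realType) (X : topologicalType) (L : tvsType R)
    (i : X -> L) : Prop :=
  [/\ hausdorff_space L,
      continuous i
    & forall (E : tvsType R) (f : X -> E), hausdorff_space E -> continuous f ->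
        exists! g : L -> E, [/\ linear g, continuous g & f = g \o i]].

(* Main.v *)
(** If L(X) has a G-base (U_a) at 0, put M a x := inf {t > 0 | i x in t U_a}. Then
   M is monotone in a, and every continuous f on X satisfies |f| <= M a for some
   a, since f extends to a continuous functional on L(X). For a finite sequence s
   and a set A, say that s dominates on A if every continuous f satisfies
   |f| <= M b on A for some b extending s. The empty sequence dominates on X, and
   no branch has all its prefixes dominating at a point. So each x has a
   neighbourhood A, which may be taken among countably many since X is separable,
   and an s dominating on A such that no one-step extension of s dominates near x.
   For fixed s and A such points form a compact set: along a sequence of them
   without cluster point one could glue witnesses of non-domination into one
   continuous function, against the domination by s. Hence X is sigma-compact.

   Conversely, the topology of L(X) is the finest locally convex one making i
   continuous. If X is the union of compact sets K_n, every modulus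
   a : N x N -> N bounding i on K_n and prescribing its continuity at the points of
   K_n generates an absolutely convex neighbourhood of 0. By compactness each
   neighbourhood of 0 contains one of these, and they decrease with a. *)

Require Import Defs.
From HB Require Import structures.
From mathcomp Require Import all_boot all_order all_algebra.
From mathcomp Require Import all_classical all_reals all_analysis.
From mathcomp Require Import ring lra.

Set Implicit Arguments.
Unset Strict Implicit.
Unset Printing Implicit Defensive.

Import Order.TTheory GRing.Theory Num.Theory.
Import numFieldNormedType.Exports.

Local Open Scope classical_set_scope.
Local Open Scope ring_scope.

(** * Resolutions of C(X) on a metric space *)

Section MetricSpace.
Context (R : realType) (X : topologicalType) (d : X -> X -> R).
Hypothesis d_metric : is_metric d.
Hypothesis nbhs_d : forall x : X,
  nbhs x = filter_from [set e : R | 0 < e] (fun e => [set y | d x y < e]).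

Let dxx x : d x x = 0. Proof. by case: d_metric => _ /(_ x x)[_ ->]. Qed.
Let dC x y : d x y = d y x. Proof. by case: d_metric. Qed.
Let d_triangle x y z : d x z <= d x y + d y z. Proof. by case: d_metric. Qed.

Let rad (m : nat) : R := m.+1%:R^-1.
Let rad_gt0 m : 0 < rad m. Proof. by rewrite invr_gt0. Qed.
Let rad_lt (e : R) : 0 < e -> exists m, rad m < e.
Proof. by move=> /ltr_add_invr[m]; rewrite add0r; exists m. Qed.

Lemma nbhs_metricP (x : X) (A : set X) :
  nbhs x A <-> exists2 e : R, 0 < e & forall y, d x y < e -> A y.
Proof. by rewrite nbhs_d; split=> -[e e0 eA]; exists e. Qed.

Lemma nbhs_metric_ball (x : X) (e : R) : 0 < e -> nbhs x [set y | d x y < e].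
Proof. by move=> e0; apply/nbhs_metricP; exists e. Qed.

Lemma metric_continuous (x : X) : continuous (d x : X -> R).
Proof.
move=> y; apply/cvgrPdist_lt => e e0.
apply: filterS (nbhs_metric_ball y e0) => z /= yz.
have := d_triangle x y z; have := d_triangle x z y.
rewrite (dC z y) real_ltr_norml ?num_real//; lra.
Qed.

(** In a metric space this says that the sequence has no cluster point. *)
Definition escaping (x : nat -> X) : Prop :=
  forall y, exists2 e : R, 0 < e & exists N, forall j, (N <= j)%N -> e <= d y (x j).

(** [g] sums the [|f j|] times tents at [x j] that vanish outside radius 1/(j+1) and are at least 1
    within half of it. The radii shrink and the centres escape, so the sum is locally finite. *)
Lemma escaping_glue (x : nat -> X) (f : nat -> X -> R) :
  escaping x -> (forall j, continuous (f j)) ->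
  exists2 g : X -> R, continuous g &
    forall j y, d (x j) y <= (2 * j.+1%:R)^-1 -> `|f j y| <= `|g y|.
Proof.
move=> xesc fcont.
pose t j y := 1 - j.+1%:R * d (x j) y.
pose h j y := `|f j y| * (t j y + `|t j y|).
have t_ge0 j y : 0 <= t j y + `|t j y|.
  by have := ler_norm (- t j y); rewrite normrN; lra.
have h_ge0 j y : 0 <= h j y by rewrite mulr_ge0.
have h_cont j : continuous (h j).
  move=> y; apply: cvgM; first by apply: cvg_norm; exact: fcont.
  have tc : t j z @[z --> y] --> t j y.
    by apply: cvgB; [exact: cvg_cst|apply: cvgMr; exact: metric_continuous].
  by apply: cvgD => //; exact: cvg_norm.
have h_loc y : exists2 e : R, 0 < e & exists N, forall z, d y z < e ->
    forall j, (N <= j)%N -> h j z = 0.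
  have [e e0 [N xN]] := xesc y; exists (e / 2); first by rewrite divr_gt0.
  (* From this index on, the centres are at distance at least e from [y] and the radii below e/2, so
     the tents vanish on the e/2-ball of [y]. *)
  exists (maxn N (Num.truncn (2 / e)).+1) => z yz j; rewrite geq_max => /andP[Nj ej].
  have := xN _ Nj; have := d_triangle y z (x j); rewrite (dC z) => H1 H2.
  have H3 : e / 2 < d (x j) z by lra.
  have H4 : 2 / e < j.+1%:R.
    by apply: lt_le_trans (truncnS_gt _) _; rewrite ler_nat ltnW.
  have H5 : 1 <= j.+1%:R * d (x j) z.
    have H5' : (2 / e) * (e / 2) = 1 by field; rewrite gt_eqF.
    rewrite -[leLHS]H5'.
    by apply: ler_pM; [exact/ltW/divr_gt0|exact/ltW/divr_gt0|exact: ltW|exact: ltW].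
  have t0 : t j z <= 0 by rewrite /t; lra.
  by rewrite /h (ler0_norm t0) subrr mulr0.
have /choice[N hN] y : exists N, forall j, (N <= j)%N -> h j y = 0.
  by have [e e0 [N yN]] := h_loc y; exists N; apply: yN; rewrite dxx.
(* The number [N y] of terms varies with [y]; by [S_eq] any sufficient number gives the same sum, so
   a fixed one works near each point. *)
pose S n y := \sum_(j < n) h j y.
have S_stable n m y : (forall j, (n <= j)%N -> h j y = 0) -> (n <= m)%N ->
    S m y = S n y.
  move=> hn nm; rewrite /S -!(big_mkord xpredT (fun j => h j y)).
  rewrite (big_cat_nat _ nm)//= [X in _ + X]big1_seq ?addr0// => j.
  by rewrite mem_index_iota => /andP[_ /andP[/hn]].
have S_eq n m y : (forall j, (n <= j)%N -> h j y = 0) ->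
    (forall j, (m <= j)%N -> h j y = 0) -> S n y = S m y.
  move=> hn hm; case/orP: (leq_total n m) => nm; last exact: S_stable.
  by symmetry; exact: S_stable.
exists (fun y => S (N y) y).
  move=> y; have [e e0 [n yn]] := h_loc y.
  have yy : d y y < e by rewrite dxx.
  rewrite /continuous_at (S_eq _ n _ (hN y) (yn _ yy)).
  have : S n z @[z --> y] --> S n y.
    by apply: cvg_big => [|i _]; [exact: add_continuous|exact: h_cont].
  apply: cvg_trans; apply: near_eq_cvg.
  apply: filterS (nbhs_metric_ball y e0) => z yz /=.
  by apply: S_eq; [exact: yn|exact: hN].
move=> j y xy.
have j0 : 0 < j.+1%:R :> R by rewrite ltr0n.
have tj : 1 <= t j y + `|t j y|.
  suff : 2^-1 <= t j y by move=> ?; rewrite ger0_norm; lra.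
  have : j.+1%:R * d (x j) y <= j.+1%:R * (2 * j.+1%:R)^-1 by rewrite ler_pM2l.
  have -> : j.+1%:R * (2 * j.+1%:R)^-1 = 2^-1 :> R by field; rewrite gt_eqF.
  by rewrite /t; lra.
have fh : `|f j y| <= h j y by rewrite -[leLHS]mulr1 ler_wpM2l.
have jN : (j < N y)%N \/ `|f j y| = 0.
  case: (ltnP j (N y)) => [|/hN hj0]; [by left|right].
  by apply/eqP; rewrite eq_le normr_ge0 -hj0 fh.
have S0 : 0 <= S (N y) y by apply: sumr_ge0.
rewrite (ger0_norm S0); case: jN => [jN|->//].
rewrite /S (bigD1 (Ordinal jN))//=; apply: (le_trans fh).
by rewrite lerDl; apply: sumr_ge0.
Qed.

(** A filter on [A] without cluster point in [A] is diagonalised against a countable base [B]: [x n]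
    avoids those [B i], i < n, whose complement is in the filter. Closedness handles the points
    outside [A]. *)
Lemma not_compact_escaping (q : nat -> X) (A : set X) :
  (forall x (e : R), 0 < e -> exists j, d x (q j) < e) ->
  closed A -> ~ compact A ->
  exists2 x : nat -> X, escaping x & forall j, A (x j).
Proof.
move=> q_dense A_closed /existsNP[F /not_implyP[F_proper /not_implyP[FA A0]]].
pose B i := if unpickle i is Some (j, m) then
  [set y | d (q j) y < rad m] else set0 : set X.
have B_base (x : X) (U : set X) : nbhs x U -> exists2 i, nbhs x (B i) & B i `<=` U.
  move=> /nbhs_metricP[e e0 eU].
  have [m me] : exists m, rad m < e / 2 by apply: rad_lt; rewrite divr_gt0.
  have [j xj] := q_dense x _ (rad_gt0 m); exists (pickle (j, m)); rewrite /B pickleK.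
    apply/nbhs_metricP; exists (rad m - d x (q j)); first by rewrite subr_gt0.
    by move=> y xy /=; have := d_triangle (q j) x y; rewrite (dC (q j) x); lra.
  move=> y /= yj; apply: eU.
  by have := d_triangle x (q j) y; lra.
have B_cover (x : X) : A x -> exists2 i, nbhs x (B i) & F (~` B i).
  move=> Ax; have : ~ cluster F x by move=> Fx; apply: A0; exists x.
  move=> /existsNP[C /existsNP[U /not_implyP[FC /not_implyP[xU CU]]]].
  have [i xi iU] := B_base _ _ xU; exists i => //.
  by apply: filterS FC => y Cy iy; apply: CU; exists y; split => //; exact: iU.
pose V n := A `&` [set y | forall i, (i < n)%N -> F (~` B i) -> ~ B i y].
have FV n : F (V n).
  apply: filterI => //; elim: n => [|n IH]; first by apply: filterS filterT.
  have [Fn|Fn] := pselect (F (~` B n)).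
    apply: filterS (filterI IH Fn) => y [yn nBy] i.
    by rewrite ltnS leq_eqVlt => /predU1P[->//|]; exact: yn.
  apply: filterS IH => y yn i.
  by rewrite ltnS leq_eqVlt => /predU1P[->/Fn//|]; exact: yn.
have /choice[x xV] n : exists x, V n x by exact: (filter_ex (FV n)).
exists x => [y|j]; last by have [] := xV j.
have [Ay|nAy] := pselect (A y).
  have [i /nbhs_metricP[e e0 ei] Fi] := B_cover _ Ay.
  exists e => //; exists i.+1 => j ij; rewrite leNgt; apply/negP => /ei.
  by have [_ /(_ i ij Fi)] := xV j.
have : nbhs y (~` A).
  by apply: open_nbhs_nbhs; split=> //; exact: closed_openC.
move=> /nbhs_metricP[e e0 eA]; exists e => //; exists 0%N => j _.
by rewrite leNgt; apply/negP => /eA; apply; have [] := xV j.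
Qed.

(** Maximal 1/(n+1)-separated sets are countable by hypothesis, and their union over n is dense. *)
Lemma dense_sequence (x0 : X) :
  (forall (D : set X) (e : R), 0 < e ->
    (forall x y, D x -> D y -> x <> y -> e <= d x y) -> countable D) ->
  exists q : nat -> X, forall x (e : R), 0 < e -> exists j, d x (q j) < e.
Proof.
move=> sep_countable.
pose sep (e : R) := [set D : set X | forall x y, D x -> D y -> x <> y -> e <= d x y].
have /choice[D hD] (n : nat) : exists D, sep (rad n) D /\
    forall x, exists2 y, D y & d x y < rad n.
  have n0 := rad_gt0 n.
  have [F Fsep Ftot|D [Dsep Dmax]] := @Zorn_bigcup X (sep (rad n)).
    move=> x y [A FA Ax] [B FB By] xy.
    case: (Ftot _ _ FA FB) => AB; first by apply: (Fsep _ FB) => //; exact: AB.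
    by apply: (Fsep _ FA) => //; exact: AB.
  exists D; split=> // x; apply: contrapT => xD.
  have far y : D y -> rad n <= d x y.
    by move=> Dy; rewrite leNgt; apply/negP => xy; apply: xD; exists y.
  apply: (Dmax (D `|` [set x])).
    split; first by move=> y; left.
    move=> /(_ x (or_intror erefl)) Dx; have := far _ Dx.
    by rewrite dxx leNgt n0.
  move=> y z [Dy|->] [Dz|->] yz //; first exact: Dsep.
    by rewrite dC; exact: far.
  exact: far.
have : countable (\bigcup_n D n).
  apply: bigcup_countable => // n _.
  by apply: (sep_countable _ (rad n)); [|case: (hD n)].
move=> /countable_injP[f finj].
exists (fun j => xget x0 [set x | (\bigcup_n D n) x /\ f x = j]) => x e e0.
have [n ne] := rad_lt e0.
have [y Dy xy] := (hD n).2 x; exists (f y).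
have yD : (\bigcup_n D n) y by exists n.
case: xgetP => [z _ [zD zy]|/(_ y)/not_andP[]//].
suff -> : z = y by exact: lt_trans ne.
by apply: finj => //; rewrite inE.
Qed.

(** * Sigma-compactness from a monotone family cofinal in C(X) *)

Section Resolution.
Variable M : (nat -> nat) -> X -> R.
Hypothesis M_mono : forall a b, (forall n, (a n <= b n)%N) ->
  forall x, M a x <= M b x.
Hypothesis M_cofinal : forall f : X -> R, continuous f ->
  exists a, forall x, `|f x| <= M a x.

Definition agree n (a b : nat -> nat) := forall i, (i < n)%N -> b i = a i.

Definition extends (s : seq nat) := agree (size s) (nth 0%N s).

Lemma agree_mkseq n a b : extends (mkseq a n) b <-> agree n a b.
Proof.
by rewrite /extends size_mkseq; split=> H i i_n; move: (H i i_n);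
  rewrite nth_mkseq.
Qed.

(* Otherwise pick [b_n] agreeing with [a] below [n] and [M b_n x > n]: the
   pointwise supremum of the [b_n] is finite and contradicts monotonicity. *)
Lemma bounded_on_branch a x :
  exists n B, forall b, agree n a b -> M b x <= B.
Proof.
apply: contrapT => unbounded.
have /choice[b hb] n : exists b, agree n a b /\ (n%:R : R) < M b x.
  apply: contrapT => nb; apply: unbounded; exists n, n%:R => b ab.
  by rewrite leNgt; apply/negP => Mb; apply: nb; exists b.
(* For n > i the value [b n i] is [a i], so only n <= i enter the maximum. *)
pose c i := (\max_(n < i.+1) b n i + a i)%N.
have bc n i : (b n i <= c i)%N.
  have [i_n|n_i] := ltnP i n.
    by rewrite (hb n).1// /c leq_addl.
  have n_i' : (n < i.+1)%N by [].
  apply: leq_trans (leq_addr _ _).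
  exact: (leq_bigmax (Ordinal n_i')).
pose n := (Num.truncn (M c x)).+1.
have := truncnS_gt (M c x); rewrite -/n ltNge => /negP; apply.
apply: le_trans (M_mono (bc n) x); exact/ltW/(hb n).2.
Qed.

(* Diagonalization: [f] exceeds, at some point of each infinite [Ds s], the bound
   valid there for all extensions of [s]; if [|f| <= M a], every [Ds (a|n)] is
   then finite, and these sets cover [D]. *)
Lemma separated_countable (D : set X) (e : R) : 0 < e ->
  (forall x y, D x -> D y -> x <> y -> e <= d x y) -> countable D.
Proof.
move=> e0 Dsep; apply: contrapT => Dunc.
pose Ds s := [set x | D x /\ exists B, forall b, extends s b -> M b x <= B].
have avoid (A : set X) (l : seq X) : infinite_set A -> exists2 x, A x & x \notin l.
  move=> Ainf; have : infinite_set (A `\` [set` l]) by exact: infinite_setD.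
  by move=> /infinite_setN0[x [Ax /negP xl]]; exists x.
have Dinf : infinite_set D by move=> /finite_set_countable.
(* Stage k picks a new point of [D], inside [Ds s] if k codes s and [Ds s] is infinite. *)
have /choice[next nextP] (lk : seq X * nat) : exists x, [/\ D x, x \notin lk.1 &
    forall s, pickle s = lk.2 -> infinite_set (Ds s) -> Ds s x].
  case: lk => l k /=.
  have [[s [sk sinf]]|nos] := pselect (exists s, pickle s = k /\ infinite_set (Ds s)).
    have [x xs xl] := avoid _ l sinf; exists x; split=> //; first by case: xs.
    by move=> t tk _; rewrite (_ : t = s)//; apply: (pcan_inj pickleK); rewrite tk.
  have [x Dx xl] := avoid _ l Dinf; exists x; split=> // s sk sinf.
  by exfalso; apply: nos; exists s.
pose L := fix L k := if k is k'.+1 then next (L k', k') :: L k' else [::].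
pose g k := next (L k, k).
have gL i j : (i < j)%N -> g i \in L j.
  elim: j => // j IH; rewrite ltnS leq_eqVlt /= inE => /predU1P[->|/IH ->].
    by rewrite eqxx.
  by rewrite orbT.
have g_inj i j : g i = g j -> i = j.
  have {}gL k l : (k < l)%N -> g k <> g l.
    move=> kl gkl; have [_ + _] := nextP (L l, l).
    by rewrite -/(g l) -gkl gL.
  by case: (ltngtP i j) => // [/gL|/gL /nesym].
have g_esc : escaping g.
  move=> y; exists (e / 2); first by rewrite divr_gt0.
  have [[k yk]|far] := pselect (exists k, d y (g k) < e / 2); last first.
    exists 0%N => j _; rewrite leNgt; apply/negP => yj.
    by apply: far; exists j.
  exists k.+1 => j kj; rewrite leNgt; apply/negP => yj.
  have : e <= d (g k) (g j).
    apply: Dsep; [by case: (nextP (L k, k))|by case: (nextP (L j, j))|].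
    by move=> /g_inj kj'; rewrite kj' ltnn in kj.
  by have := d_triangle (g k) y (g j); rewrite (dC (g k) y); lra.
have /choice[c hc] k : exists c, forall s, pickle s = k -> infinite_set (Ds s) ->
    forall b, extends s b -> M b (g k) < c.
  have [[s [sk sinf]]|nos] := pselect (exists s, pickle s = k /\ infinite_set (Ds s)).
    have [_ _ /(_ s sk sinf)[_ [B hB]]] := nextP (L k, k).
    exists (B + 1) => t tk _ b; rewrite (_ : t = s).
      by move=> /hB; rewrite -/(g k); lra.
    by apply: (pcan_inj pickleK); rewrite tk.
  by exists 0 => s sk sinf; exfalso; apply: nos; exists s.
have [f f_cont fc] := @escaping_glue g (fun k _ => c k) g_esc
  (fun k => @cst_continuous X R (c k)).
have [a fa] := M_cofinal f_cont.
have Ds_fin n : finite_set (Ds (mkseq a n)).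
  apply: contrapT => inf; set s := mkseq a n in inf.
  have as_ : extends s a by apply/agree_mkseq.
  have := hc _ s erefl inf a as_; apply/negP; rewrite -leNgt.
  apply: le_trans (fa _); apply: le_trans (fc (pickle s) _ _).
    exact: ler_norm.
  by rewrite dxx invr_ge0 mulr_ge0.
apply: Dunc; apply: (@sub_countable _ _ _ (\bigcup_n Ds (mkseq a n))).
  apply: subset_card_le => x Dx; have [n [B nB]] := bounded_on_branch a x.
  by exists n => //; split=> //; exists B => b /agree_mkseq; exact: nB.
by apply: bigcup_countable => // n _; exact: finite_set_countable.
Qed.

Definition dominates (s : seq nat) (A : set X) := forall f : X -> R,
  continuous f -> exists2 b, extends s b & forall x, A x -> `|f x| <= M b x.

Lemma dominates_sub s A B : A `<=` B -> dominates s B -> dominates s A.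
Proof. by move=> AB sB f /sB[b sb fb]; exists b => // x /AB; exact: fb. Qed.

(** Halving [r] keeps small balls about these points inside the ball where [s] dominates; the
    non-strict inequality makes the set closed. *)
Definition bad_set (s : seq nat) (q : X) (r : R) := [set x |
  [/\ dominates s [set y | d q y < r], d q x <= r / 2 &
      forall k e, 0 < e -> ~ dominates (rcons s k) [set y | d x y < e]]].

(** A ball about a limit of bad points contains a ball about a bad point, to which domination would
    pass. *)
Lemma closed_bad_set s q r : closed (bad_set s q r).
Proof.
move=> x /= cl_x.
have near_bad (e : R) : 0 < e -> exists2 y, bad_set s q r y & d x y < e.
  by move=> e0; have [y []] := cl_x _ (nbhs_metric_ball x e0); exists y.
split.
- by have [y [] //] := near_bad 1 ltr01.
- rewrite leNgt; apply/negP => qx.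
  have [|y [_ qy _] xy] := near_bad (d q x - r / 2); first by rewrite subr_gt0.
  by have := d_triangle q y x; rewrite (dC y); lra.
- move=> k e e0 xe.
  have [|y [_ _ ybad] xy] := near_bad (e / 2); first by rewrite divr_gt0.
  have e20 : 0 < e / 2 by rewrite divr_gt0.
  apply: (ybad k _ e20); apply: dominates_sub xe => z /= yz.
  by have := d_triangle x y z; lra.
Qed.

Lemma extends_rcons s b : extends s b -> extends (rcons s (b (size s))) b.
Proof.
move=> sb i; rewrite size_rcons ltnS leq_eqVlt nth_rcons.
by case: ltngtP => [i_s _||-> _] //; exact: sb.
Qed.

(* Witnesses [f_j] of the non-domination by [rcons s j] near [x j] are glued to a
   single [g]; some [b] extending [s] dominates it, contradicting the choice of
   [f_k] for [k = b (size s)]. *)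
Lemma bad_set_not_escaping s q r (x : nat -> X) : 0 < r ->
  escaping x -> ~ (forall j, bad_set s q r (x j)).
Proof.
move=> r0 x_esc xbad.
pose e (j : nat) : R := Num.min (2 * j.+1%:R)^-1 (r / 2).
have e0 j : 0 < e j by rewrite lt_min invr_gt0 mulr_gt0//= divr_gt0.
have /choice[f hf] j : exists f : X -> R, continuous f /\
    ~ exists2 b, extends (rcons s j) b &
        forall y, d (x j) y < e j -> `|f y| <= M b y.
  have [_ _ /(_ j _ (e0 j)) xj] := xbad j; apply: contrapT => nf.
  by apply: xj => f fc; apply: contrapT => fb; apply: nf; exists f.
have [g g_cont fg] := escaping_glue x_esc (fun j => (hf j).1).
have [sq _ _] := xbad 0%N; have [b sb gb] := sq _ g_cont.
apply: (hf (b (size s))).2; exists b; first exact: extends_rcons.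
move=> y; rewrite lt_min => /andP[y1 y2].
apply: le_trans (fg _ _ (ltW y1)) (gb _ _) => /=.
have [_ qx _] := xbad (b (size s)).
by have := d_triangle q (x (b (size s))) y; lra.
Qed.

(* Outside all bad sets one builds a branch [a] all of whose prefixes dominate
   near [x], against [bounded_on_branch]. *)
Lemma bad_sets_cover (q : nat -> X) x :
  (forall x (e : R), 0 < e -> exists j, d x (q j) < e) ->
  exists s j m, bad_set s (q j) (rad m) x.
Proof.
move=> q_dense; apply: contrapT => x_good.
pose good s := exists2 e, 0 < e & dominates s [set y | d x y < e].
have /choice[next nextP] s : exists k, good s -> good (rcons s k).
  have [[e e0 se]|] := pselect (good s); last by exists 0%N.
  have e20 : 0 < e / 2 by rewrite divr_gt0.
  have [m me] := rad_lt e20; have r0 := rad_gt0 m.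
  have r20 : 0 < rad m / 2 by rewrite divr_gt0.
  have [j xj] := q_dense x _ r20.
  apply: contrapT => no_k; apply: x_good; exists s, j, m; split.
  - apply: dominates_sub se => y /= qy.
    by have := d_triangle x (q j) y; lra.
  - by rewrite dC ltW.
  - move=> k e' e'0 ke'; apply: no_k; exists k => _; by exists e'.
pose s := fix s n := if n is n'.+1 then rcons (s n') (next (s n')) else [::].
have s_good n : good (s n).
  elim: n => [|n IH]; last exact: nextP.
  exists 1 => // f /M_cofinal[b fb]; exists b => //.
pose a n := next (s n).
have sE n : s n = mkseq a n by elim: n => //= n IH; rewrite mkseqS -IH.
have [n [B nB]] := bounded_on_branch a x.
have [e e0 ne] := s_good n.
have [b sb fb] := ne (cst (B + 1)) (@cst_continuous X R (B + 1)).
have := fb x; rewrite /= dxx => /(_ e0).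
have : M b x <= B by apply: nB; apply/agree_mkseq; rewrite -sE.
by have := ler_norm (B + 1); lra.
Qed.

Lemma resolution_sigma_compact : sigma_compact X.
Proof.
have [[x0 _]|X0] := pselect ([set: X] !=set0); last first.
  exists (fun=> set0) => [n|]; first exact: compact0.
  apply/seteqP; split=> // x _.
  by exfalso; apply: X0; exists x.
have [q q_dense] := dense_sequence x0 separated_countable.
exists (fun n => if unpickle n is Some (s, j, m) then
    bad_set s (q j) (rad m) else set0).
  move=> n; case: unpickle => [[[s j] m]|]; last exact: compact0.
  (* Being closed, a non-compact bad set would contain an escaping sequence. *)
  apply: contrapT => ncpt.
  have [x xesc] := not_compact_escaping q_dense (@closed_bad_set s (q j) (rad m)) ncpt.
  exact: bad_set_not_escaping.
apply/seteqP; split=> // x _; have [s [j [m xs]]] := bad_sets_cover x q_dense.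
by exists (pickle (s, j, m)) => //; rewrite pickleK.
Qed.

End Resolution.

End MetricSpace.

(** * From a G-base at 0 to a resolution of C(X) *)

Section GBaseResolution.
Context (R : realType) (L : tvsType R).

Lemma nbhs0_absorbs (A : set L) (z : L) : nbhs (0 : L) A ->
  exists2 t : R, 0 < t & A (t^-1 *: z).
Proof.
move=> A0; have /= := @scale_continuous R L (0, z) A.
rewrite scale0r => /(_ A0)[[/= B C] [B0 Cz] BCA].
have [e e0 eB] : exists2 e : R, 0 < e & forall s, `|s| < e -> B s.
  have /nbhs_ballP[e e0 eB] := B0; exists e => // s se; apply: eB.
  by rewrite -ball_normE /= sub0r normrN.
exists (e / 2)^-1; first by rewrite invr_gt0 divr_gt0.
rewrite invrK; apply: (BCA (e / 2, z)); split => /=.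
  by apply: eB; rewrite gtr0_norm ?divr_gt0//; lra.
exact: nbhs_singleton.
Qed.

(** [M a x] is the Minkowski gauge of [U a] at [i x]. The functional extending [f] is below 1 in
    modulus on some [U a], so [i x] in t [U a] forces |f x| < t. *)
Lemma G_base_resolution (X : topologicalType) (i : X -> L) :
  has_G_base_at (0 : L) ->
  (forall f : X -> R, continuous f ->
    exists g : L -> R^o, [/\ linear g, continuous g & f = g \o i]) ->
  exists2 M : (nat -> nat) -> X -> R,
    forall a b, (forall n, (a n <= b n)%N) -> forall x, M a x <= M b x &
    forall f : X -> R, continuous f -> exists a, forall x, `|f x| <= M a x.
Proof.
move=> [U U_base U_mono] i_ext.
have U0 a : nbhs (0 : L) (U a) by rewrite U_base; exists a.
pose T a x := [set t : R | 0 < t /\ U a (t^-1 *: i x)].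
have T_neq0 a x : T a x !=set0.
  by have [t t0 tU] := nbhs0_absorbs (i x) (U0 a); exists t.
have T_lb a x : lbound (T a x) 0 by move=> t [/ltW].
exists (fun a x => inf (T a x)).
  move=> a b ab x; apply: lb_le_inf => // t [t0 tU].
  by apply: ge_inf; [exists 0; exact: T_lb|split=> //; exact: U_mono tU].
move=> f /i_ext[g [g_lin g_cont fg]].
have gZ (t : R) z : g (t *: z) = t * g z.
  have g0 : g 0 = 0.
    have := g_lin 1 0 0; rewrite scaler0 addr0 scale1r => /eqP.
    by rewrite -subr_eq0 opprD addNKr oppr_eq0 => /eqP.
  by have := g_lin t z 0; rewrite !addr0 g0 addr0.
have g0 : g 0 = 0 by rewrite -(scale0r 0) gZ mul0r.
have : nbhs (0 : L) [set z | `|g z| < 1].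
  have := g_cont 0; rewrite /continuous_at g0 => /cvgr_norm_lt; apply.
  by rewrite normr0.
rewrite U_base => -[a _ aU]; exists a => x; apply: lb_le_inf => // t [t0 /aU /=].
rewrite gZ normrM gtr0_norm ?invr_gt0// mulrC ltr_pdivrMr// mul1r fg.
exact: ltW.
Qed.

End GBaseResolution.

(** * Locally convex topologies and spans of disks *)

Section AbsolutelyConvex.
Context (R : realType) (V : lmodType R).

Definition abs_convex (A : set V) := A 0 /\
  forall x y (s t : R), A x -> A y -> `|s| + `|t| <= 1 -> A (s *: x + t *: y).

Lemma abs_convexZ A x (s : R) : abs_convex A -> A x -> `|s| <= 1 -> A (s *: x).
Proof.
move=> [A0 cA] Ax s1; have := cA x 0 s 0 Ax A0.
by rewrite scaler0 addr0 normr0 addr0; apply.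
Qed.

Lemma abs_convexI A B : abs_convex A -> abs_convex B -> abs_convex (A `&` B).
Proof.
move=> [A0 cA] [B0 cB]; split=> // x y s t [Ax Bx] [Ay By] st.
by split; [exact: cA|exact: cB].
Qed.

Lemma abs_convex_scale_preimage A (c : R) :
  abs_convex A -> abs_convex [set z | A (c *: z)].
Proof.
move=> [A0 cA]; split=> [|x y s t Ax Ay st] /=; first by rewrite scaler0.
by rewrite scalerDr !scalerA !(mulrC c) -!scalerA; exact: cA.
Qed.

Lemma abs_convex_scale_le A (s t : R) z : abs_convex A ->
  0 <= s <= t -> A (t *: z) -> A (s *: z).
Proof.
move=> cA /andP[s0 st] At.
have [t0|t0] := eqVneq t 0.
  have -> : s = 0 by apply/le_anti; rewrite s0 -{1}t0 st.
  by rewrite scale0r; case: cA.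
have t_gt0 : 0 < t by rewrite lt_neqAle eq_sym t0 (le_trans s0).
have -> : s *: z = (s / t) *: (t *: z) by rewrite scalerA divfK.
apply: abs_convexZ => //.
by rewrite ger0_norm ?divr_ge0 ?(le_trans s0)// ler_pdivrMr// mul1r.
Qed.

Lemma abs_convex_half A x y : abs_convex A ->
  A (2 *: x) -> A (2 *: y) -> A (x + y).
Proof.
move=> [A0 cA] Ax Ay; have := cA _ _ (2^-1) (2^-1) Ax Ay.
by rewrite !scalerA mulVf// !scale1r; apply; rewrite ger0_norm//; lra.
Qed.

(** One scalar per point suffices in [lc_absorbs], as absolute convexity yields all smaller ones;
    [lc_halve] serves both addition and scaling. *)
Record lc_base := LcBase {
  lc_sets :> set (set V);
  lc_neq0 : lc_sets !=set0;
  lc_abs_convex : forall A, lc_sets A -> abs_convex A;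
  lc_absorbs : forall A z, lc_sets A -> exists2 t : R, 0 < t & A (t *: z);
  lc_setI : forall A B, lc_sets A -> lc_sets B ->
    exists2 C, lc_sets C & C `<=` A `&` B;
  lc_halve : forall A, lc_sets A ->
    exists2 B, lc_sets B & forall x, B x -> A (2 *: x) }.

(** An alias remembering [B], so that each base can put its own topology on [V]. *)
Definition lc_type (B : lc_base) : Type := V.

Definition lc_nbhs (B : lc_base) (x : lc_type B) : set (set (lc_type B)) :=
  [set A | exists2 U, lc_sets B U & forall u, U u -> A (x + u)].

End AbsolutelyConvex.

(** * The locally convex topology of a base at 0 *)

Section LocallyConvexTopology.
Context (R : realType) (V : lmodType R) (B : lc_base V).
Local Notation E := (lc_type B).

HB.instance Definition _ := GRing.Lmodule.copy E V.
HB.instance Definition _ := hasNbhs.Build E (@lc_nbhs R V B).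

Lemma lc_nbhs_base (x : E) U : lc_sets B U -> nbhs x [set z : E | U (z - x)].
Proof. by move=> BU; exists U => // u Uu /=; rewrite addrC addKr. Qed.

Lemma lc_nbhs_filter (x : E) : ProperFilter (nbhs x).
Proof.
split.
  by move=> [U BU /(_ 0)]; apply; have [] := lc_abs_convex BU.
split.
- by have [U BU] := lc_neq0 B; exists U.
- move=> P Q [U BU UP] [W BW WQ]; have [C BC CUW] := lc_setI BU BW.
  by exists C => // u /CUW[Uu Wu]; split; [exact: UP|exact: WQ].
- by move=> P Q PQ [U BU UP]; exists U => // u /UP/PQ.
Qed.

Lemma lc_nbhs_singleton (x : E) (A : set E) : nbhs x A -> A x.
Proof.
by move=> [U BU /(_ 0)]; rewrite addr0; apply; have [] := lc_abs_convex BU.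
Qed.

Lemma lc_nbhs_nbhs (x : E) (A : set E) : nbhs x A -> nbhs x (nbhs^~ A).
Proof.
move=> [U BU UA]; have [W BW WU] := lc_halve BU.
exists W => // w Ww; exists W => // u Wu.
rewrite -addrA; apply: UA; apply: abs_convex_half; [exact: lc_abs_convex BU| |];
  exact: WU.
Qed.

HB.instance Definition _ := Nbhs_isNbhsTopological.Build E
  lc_nbhs_filter lc_nbhs_singleton lc_nbhs_nbhs.

Lemma lc_add_continuous : continuous (fun x : E * E => x.1 + x.2).
Proof.
move=> [x y] A /= [U BU UA]; have [W BW WU] := lc_halve BU.
exists ([set z | W (z - x)], [set z | W (z - y)]).
  by split; exact: lc_nbhs_base.
move=> [x' y'] [/= xx' yy'] /=.
have -> : x' + y' = x + y + ((x' - x) + (y' - y)).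
  by rewrite addrACA (addrC x) subrK (addrC y) subrK.
apply: UA; apply: abs_convex_half; [exact: lc_abs_convex BU| |]; exact: WU.
Qed.

Lemma lc_halve_iter U n : lc_sets B U ->
  exists2 W, lc_sets B W & forall x, W x -> U ((2 ^+ n) *: x).
Proof.
move=> BU; elim: n => [|n [W BW WU]].
  by exists U => // x; rewrite expr0 scale1r.
have [W' BW' W'W] := lc_halve BW; exists W' => // x /W'W /WU.
by rewrite scalerA -exprSr.
Qed.

(** In s y - r x = (s - r) x + s (y - x), absorption of x handles the first summand; the second uses
    |s| <= 2^n and n further halvings. *)
Lemma lc_scale_continuous : continuous (fun z : R^o * E => z.1 *: z.2).
Proof.
move=> [r x] A /= [U BU UA]; have [W BW WU] := lc_halve BU.
have [t t0 tW] := lc_absorbs (x : V) BW.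
pose n := (Num.truncn (`|r| + t)).+1.
have rn : `|r| + t <= 2 ^+ n.
  apply: le_trans (ltW (truncnS_gt _)) _.
  by rewrite -natrX ler_nat ltnW// ltn_expl.
have [W' BW' W'W] := lc_halve_iter n BW.
exists ([set s : R^o | `|s - r| < t], [set z | W' (z - x)]).
  split; last exact: lc_nbhs_base.
  by apply/nbhs_ballP; exists t => // s; rewrite -ball_normE /= distrC.
move=> [s y] [/= sr xy].
have -> : s *: y = r *: x + ((s - r) *: x + s *: (y - x)).
  by rewrite scalerBl addrA (addrC (r *: x)) subrK scalerBr (addrC (s *: x)) subrK.
apply: UA; apply: abs_convex_half; [exact: lc_abs_convex BU| |]; apply: WU.
  have cW := lc_abs_convex BW.
  have -> : (s - r) *: x = ((s - r) / t) *: (t *: x).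
    by rewrite scalerA divfK// gt_eqF.
  apply: abs_convexZ => //.
  by rewrite normrM normfV (gtr0_norm t0) ler_pdivrMr// mul1r ltW.
have cW := lc_abs_convex BW.
have n0 : 0 < 2 ^+ n :> R by rewrite exprn_gt0.
have -> : s *: (y - x) = (s / 2 ^+ n) *: (2 ^+ n *: (y - x)).
  by rewrite scalerA divfK// gt_eqF.
apply: abs_convexZ => //; first exact: W'W.
rewrite normrM normfV (gtr0_norm n0) ler_pdivrMr// mul1r; apply: le_trans rn.
by have := ler_normD (s - r) r; rewrite subrK; lra.
Qed.

(** The base consists of the open convex sets: the interior of x + U is convex, since an increment w
    common to two points passes to their convex combinations. *)
Lemma lc_locally_convex : exists2 C : set_system E,
  (forall b, b \in C -> convex_set b) & basis C.
Proof.
exists [set b | open b /\ convex_set b]; first by move=> b; rewrite inE => -[].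
split; first by move=> b [].
move=> x A [U BU UA]; exists [set z | nbhs z [set y : E | U (y - x)]].
  split; last exact: lc_nbhs_base.
  split.
    by rewrite openE => z zU; exact: lc_nbhs_nbhs.
  move=> y z p; rewrite !inE => -[W1 BW1 W1U] [W2 BW2 W2U].
  have [W BW W12] := lc_setI BW1 BW2; exists W => // w /W12[/W1U yw /W2U zw] /=.
  have [_ /(_ _ _ p%:num (1 - p%:num) yw zw)] := lc_abs_convex BU.
  have p01 : 0 <= 1 - p%:num by rewrite subr_ge0.
  rewrite (ger0_norm p01) ger0_norm// addrC subrK => /(_ (lexx _)).
  congr (U _).
  have -> : conv p y z = p%:num *: y + (1 - p%:num) *: z :> V by [].
  rewrite -!(addrA _ w) [LHS](_ : _ = p%:num *: (y : V) + (1 - p%:num) *: z + (w - x))//.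
  by move: (w - x) => e; rewrite !scalerDr addrACA -scalerDl (addrC p%:num) subrK scale1r.
by move=> z /lc_nbhs_singleton /= /UA; rewrite addrC subrK.
Qed.

HB.instance Definition _ := PreTopologicalLmod_isTvs.Build R E
  lc_add_continuous lc_scale_continuous lc_locally_convex.
(* The factory above only declares the uniform structure. *)
HB.instance Definition _ :=
  PreTopologicalNmodule_isTopologicalNmodule.Build E lc_add_continuous.
HB.instance Definition _ :=
  TopologicalNmodule_isTopologicalLmodule.Build R E lc_scale_continuous.
HB.instance Definition _ := Uniform_isTvs.Build R E lc_locally_convex.

End LocallyConvexTopology.

(** * Absolutely convex neighbourhoods and spans of disks *)

Section Gauge.
Context (R : realType) (L : tvsType R).

(** A convex neighbourhood C of 0 is intersected with -C; signs of coefficients then move into the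
    points, and a coefficient sum below 1 is completed by the point 0. *)
Lemma nbhs0_abs_convex (A : set L) : nbhs (0 : L) A ->
  exists2 U, nbhs (0 : L) U & abs_convex U /\ U `<=` A.
Proof.
have [B B_convex [B_open B_base]] := @locally_convex R L.
move=> /(B_base 0)[C [BC C0] CA].
have C_nbhs : nbhs (0 : L) C by apply: open_nbhs_nbhs; split=> //; exact: B_open.
have C_conv (x y : L) (s t : R) : 0 <= s -> 0 <= t -> s + t = 1 -> C x -> C y ->
    C (s *: x + t *: y).
  move=> s0 t0 st Cx Cy; have s01 : 0 <= s <= 1 by lra.
  have := B_convex C (mem_set BC) x y (Itv01 s0 (andP s01).2) (mem_set Cx) (mem_set Cy).
  have -> : t = 1 - s by lra.
  by rewrite inE.
exists (C `&` -%R @` C); first by apply: filterI => //; exact: nbhs0N.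
split; last by move=> x [/CA].
have sym (x : L) : (C `&` -%R @` C) x -> C x /\ C (- x).
  by move=> [Cx [y Cy yx]]; split=> //; rewrite -yx opprK.
have C_sgn (x : L) (s : R) : (C `&` -%R @` C) x -> exists2 y, C y & s *: x = `|s| *: y.
  move=> /sym[Cx CNx]; case: (leP 0 s) => s0.
    by exists x; rewrite // ger0_norm.
  by exists (- x); rewrite // ltr0_norm// scalerN scaleNr opprK.
have CC (x y : L) (s t : R) : (C `&` -%R @` C) x -> (C `&` -%R @` C) y ->
    `|s| + `|t| <= 1 -> C (s *: x + t *: y).
  move=> /(C_sgn _ s)[x' Cx ->] /(C_sgn _ t)[y' Cy ->].
  have := normr_ge0 s; have := normr_ge0 t.
  move: (`|s|) (`|t|) => {}s {}t t0 s0 st.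
  have [st0|st0] := eqVneq (s + t) 0.
    have -> : s = 0 by lra.
    have -> : t = 0 by lra.
    by rewrite !scale0r addr0.
  have st_gt0 : 0 < s + t by rewrite lt_neqAle eq_sym st0 addr_ge0.
  have Cz : C ((s / (s + t)) *: x' + (t / (s + t)) *: y').
    by apply: C_conv; rewrite ?divr_ge0 ?(ltW st_gt0)// -mulrDl divff.
  have := C_conv _ 0 (s + t) (1 - (s + t)) (ltW st_gt0) _ _ Cz C0.
  rewrite scaler0 addr0 scalerDr !scalerA !(mulrC (s + t)) !divfK//.
  by apply; [rewrite subr_ge0|rewrite addrC subrK].
split; first by split=> //; exists 0 => //; rewrite oppr0.
move=> x y s t Cx Cy st; split; first exact: CC.
exists (- s *: x + - t *: y); first by apply: CC => //; rewrite !normrN.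
by rewrite !scaleNr -opprD opprK.
Qed.

Record disk := Disk { disk_set :> set L; disk_abs_convex : abs_convex disk_set }.

(** By absolute convexity the multiples of [D] already fill its linear span. *)
Definition disk_span (D : disk) : {pred L} :=
  [pred z : L | `[< exists2 t : R, 0 < t & disk_set D (t *: z) >]].

Lemma disk_spanP (D : disk) z :
  reflect (exists2 t : R, 0 < t & disk_set D (t *: z)) (z \in disk_span D).
Proof. by rewrite inE; exact: asboolP. Qed.

Lemma disk_span_closed (D : disk) : submod_closed (disk_span D).
Proof.
have [D0 cD] := disk_abs_convex D; split.
  by apply/disk_spanP; exists 1; rewrite ?scaler0.
move=> a x y /disk_spanP[s s0 sx] /disk_spanP[t t0 ty]; apply/disk_spanP.
(* The sum of the absolute values of the coefficients in a x + y = (a/s)(s x) + (1/t)(t y). *)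
pose c := s^-1 * `|a| + t^-1.
have c0 : 0 < c.
  by rewrite ltr_wpDl ?invr_gt0// mulr_ge0 ?invr_ge0// ltW.
exists c^-1; first by rewrite invr_gt0.
have -> : c^-1 *: (a *: x + y) =
    (c^-1 * a * s^-1) *: (s *: x) + (c^-1 * t^-1) *: (t *: y).
  by rewrite scalerDr !scalerA !divfK ?gt_eqF.
apply: cD => //.
rewrite !normrM !normfV (gtr0_norm c0) (gtr0_norm s0) (gtr0_norm t0).
by rewrite -mulrA -mulrDr (mulrC `|a|) -/c mulVf ?gt_eqF.
Qed.

HB.instance Definition _ (D : disk) :=
  GRing.isSubmodClosed.Build R L (disk_span D) (disk_span_closed D).

Record span_type (D : disk) :=
  SpanType { span_val : L; span_valP : span_val \in disk_span D }.

Section SpanType.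
Variable D : disk.

HB.instance Definition _ := [isSub for @span_val D].
HB.instance Definition _ := [Choice of span_type D by <:].
HB.instance Definition _ := [SubChoice_isSubLmodule of span_type D by <:].

(* The topology of uniform size along [D] joined with that of [L]; the latter
   makes the span Hausdorff. *)
Definition span_base_sets : set (set (span_type D)) :=
  [set W | exists U (c : R), [/\ nbhs (0 : L) U, abs_convex U, 0 < c &
    W = [set z | U (val z) /\ disk_set D (c *: val z)]]].

Lemma span_base_abs_convex W : span_base_sets W -> abs_convex W.
Proof.
move=> [U [c [_ cU c0 ->]]].
have [UD0 cUD] := abs_convexI cU (abs_convex_scale_preimage c (disk_abs_convex D)).
pose v := (val : span_type D -> L); have vD x y : v (x + y) = v x + v y by exact: raddfD.
have v0 : v 0 = 0 by exact: raddf0.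
have vZ (s : R) x : v (s *: x) = s *: v x by exact: linearZ.
split; first by move: UD0; rewrite -v0.
by move=> x y s t Wx Wy /(cUD _ _ s t Wx Wy); rewrite -!vZ -vD.
Qed.

Lemma span_base_absorbs W z : span_base_sets W ->
  exists2 t : R, 0 < t & W (t *: z).
Proof.
move=> [U [c [U0 cU c0 ->]]].
have [t t0 tU] := nbhs0_absorbs (val z) U0.
have /disk_spanP[s s0 sD] := span_valP z.
pose r : R := Num.min t^-1 (s / c).
have r0 : 0 < r by rewrite lt_min invr_gt0 t0 divr_gt0.
exists r => //=; rewrite linearZ/=; split.
  by apply: abs_convex_scale_le tU => //; rewrite (ltW r0) /r ge_min lexx.
rewrite scalerA; apply: (abs_convex_scale_le (disk_abs_convex D) _ sD).
by rewrite mulr_ge0 ?(ltW c0) ?(ltW r0)//= -ler_pdivlMr// /r ge_min lexx orbT.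
Qed.

Lemma span_base_setI A B : span_base_sets A -> span_base_sets B ->
  exists2 C, span_base_sets C & C `<=` A `&` B.
Proof.
move=> [U [a [U0 cU a0 ->]]] [W [b [W0 cW b0 ->]]].
exists [set z | (U `&` W) (val z) /\ disk_set D (Num.max a b *: val z)].
  exists (U `&` W), (Num.max a b); split=> //; first exact: filterI.
    exact: abs_convexI.
  by rewrite lt_max a0.
move=> z /= [[Uz Wz] Dz]; do 2!split=> //;
  apply: (abs_convex_scale_le (disk_abs_convex D) _ Dz).
  by rewrite (ltW a0) le_max lexx.
by rewrite (ltW b0) le_max lexx orbT.
Qed.

Lemma span_base_halve A : span_base_sets A ->
  exists2 B, span_base_sets B & forall x, B x -> A (2 *: x).
Proof.
move=> [U [c [U0 cU c0 ->]]].
exists [set z | U (2 *: val z) /\ disk_set D (c * 2 *: val z)].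
  exists [set z | U (2 *: z)], (c * 2); split=> //.
  - have := @scale_continuous R L (2, 0) U; rewrite /= scaler0 => /(_ U0).
    move=> [[/= P Q] [P2 Q0] PQU]; apply: filterS Q0 => z Qz.
    by apply: (PQU (2, z)); split => //; exact: nbhs_singleton.
  - exact: abs_convex_scale_preimage.
  - by rewrite mulr_gt0.
move=> x [Ux Dx]; have x2 : val (2 *: x) = 2 *: val x by exact: linearZ.
by split; rewrite x2 ?scalerA.
Qed.

Lemma span_base_neq0 : span_base_sets !=set0.
Proof.
exists [set z | setT (val z) /\ disk_set D (1 *: val z)], setT, 1; split=> //.
exact: filterT.
Qed.

Definition span_base : lc_base (span_type D) := LcBase span_base_neq0
  span_base_abs_convex span_base_absorbs span_base_setI span_base_halve.

Definition span_tvs : tvsType R := lc_type span_base.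

Lemma span_val_continuous : continuous (val : span_tvs -> L).
Proof.
move=> z A /= zA; have : nbhs (0 : L) [set u | A (val z + u)].
  have := @add_continuous L (val z, 0) A; rewrite /= addr0 => /(_ zA).
  move=> [[/= P Q] [P2 Q0] PQA]; apply: filterS Q0 => u Qu.
  by apply: (PQA (val z, u)); split => //; exact: nbhs_singleton.
move=> /nbhs0_abs_convex[U U0 [cU UA]].
exists [set u | U (val u) /\ disk_set D (1 *: val u)]; first by exists U, 1.
move=> u [Uu _]; have vD : val (z + u : span_type D) = val z + val u.
  by exact: raddfD.
by move: (UA _ Uu) => /=; rewrite -[span_val z + _]vD.
Qed.

End SpanType.

End Gauge.

(** * The free locally convex space *)

Section FreeLocallyConvex.
Context (R : realType) (X : topologicalType) (L : tvsType R) (i : X -> L).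
Hypothesis i_free : is_free_lcs i.

Let i_cont : continuous i. Proof. by case: i_free. Qed.

Lemma near_scale_diff (x : X) (W : set L) (c : R) : nbhs (0 : L) W ->
  \forall y \near x, W (c *: (i y - i x)).
Proof.
move=> W0; have cW : nbhs (0 : L) [set z | W (c *: z)].
  have := @scale_continuous R L (c, 0) W; rewrite /= scaler0 => /(_ W0).
  move=> [[/= P Q] [P2 Q0] PQW]; apply: filterS Q0 => z Qz.
  by apply: (PQW (c, z)); split => //; exact: nbhs_singleton.
have : nbhs x (i @^-1` (+%R (i x) @` [set z | W (c *: z)])).
  exact: (i_cont (nbhsT _ cW)).
apply: filterS => y [z Wz zy].
by rewrite -zy addrC addKr.
Qed.

(* The hypotheses let [i] factor continuously through the span [E] of [D]; by
   uniqueness the induced [g : L -> E] is a section of the inclusion, so the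
   continuity of [g] at 0 is the claim. *)
Lemma free_abs_convex_nbhs (D : set L) : abs_convex D ->
  (forall x, exists2 t : R, 0 < t & D (t *: i x)) ->
  (forall x (c : R), 0 < c -> \forall y \near x, D (c *: (i y - i x))) ->
  nbhs (0 : L) D.
Proof.
move=> D_abs D_absorbs D_near; pose E := span_tvs (Disk D_abs).
have iE x : i x \in disk_span (Disk D_abs) by apply/disk_spanP; exact: D_absorbs.
pose f x : E := SpanType (iE x).
have f_cont : continuous f.
  move=> x A [_ [U [c [U0 _ c0 ->]]] UA].
  have : \forall y \near x, U (1 *: (i y - i x)) /\ D (c *: (i y - i x)).
    by apply: filterI; [exact: near_scale_diff|exact: D_near].
  apply: filterS => y; rewrite scale1r => -[Uy Dy].
  have fy : f x + (f y - f x) = f y by rewrite addrC subrK.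
  have vB : val (f y - f x : span_type (Disk D_abs)) = i y - i x by exact: raddfB.
  by rewrite /= -fy; apply: UA; split; rewrite vB.
have val_cont := @span_val_continuous R L (Disk D_abs).
have E_hausdorff : hausdorff_space E.
  move=> p q pq; apply: val_inj; case: i_free => L_hausdorff _ _.
  apply: L_hausdorff => A B pA qB.
  have [z [Az Bz]] := pq _ _ (val_cont _ _ pA) (val_cont _ _ qB).
  by exists (val z).
have [_ _ univ] := i_free.
have [g [[g_lin g_cont fg] _]] := univ E f E_hausdorff f_cont.
have val_g z : val (g z) = z.
  have [h [_ h_uniq]] := univ L i (let: And3 H _ _ := i_free in H) i_cont.
  have h_g : h = val \o g.
    apply: h_uniq; split.
    - by move=> a x y /=; rewrite g_lin; exact: (linearP (val : span_type _ -> L)).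
    - by move=> x A xA; exact: (g_cont x _ (val_cont (g x) _ xA)).
    - by apply/funext => x /=; have /(congr1 (fun u => val (u x))) := fg.
  have h_id : h = id by apply: h_uniq; split=> // x A.
  by have := congr1 (fun u => u z) h_g; rewrite h_id /= => <-.
have g0 : g 0 = 0 by apply: val_inj; rewrite val_g raddf0.
have D_nbhs : nbhs (g 0) [set z : E | setT (val z) /\ D (1 *: val z)].
  rewrite g0; exists [set z : E | setT (val z) /\ D (1 *: val z)].
    by exists setT, 1; split=> //; exact: filterT.
  by move=> u; rewrite add0r.
have : nbhs (0 : L) (g @^-1` [set z : E | setT (val z) /\ D (1 *: val z)]).
  exact: (g_cont 0 _ D_nbhs).
by apply: filterS => z [_]; rewrite scale1r val_g.
Qed.

Lemma has_G_base_translate : has_G_base_at (0 : L) -> has_G_base L.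
Proof.
move=> [U U_base U_mono] z; exists (fun a => [set y | U a (y - z)]); last first.
  by move=> a b ab y /=; exact: U_mono.
apply/seteqP; split=> A.
  move=> zA; have : nbhs (0 : L) [set u | A (z + u)].
    have := nbhsB (- z) zA; rewrite addNr; apply: filterS => u [y Ay <-] /=.
    by rewrite addNKr.
  rewrite U_base => -[a _ aA]; exists a => // y /= /aA /=.
  by rewrite addrC subrK.
move=> [a _ aA]; have : nbhs (0 : L) (U a) by rewrite U_base; exists a.
move=> /(nbhsT z); apply: filterS => y [u Uu <-]; apply: aA.
by rewrite /= addrC addKr.
Qed.

(** * A G-base from a countable compact cover *)

Section SigmaCompact.
Context (d : X -> X -> R) (K : nat -> set X).
Hypothesis d_metric : is_metric d.
Hypothesis nbhs_d : forall x : X,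
  nbhs x = filter_from [set e : R | 0 < e] (fun e => [set y | d x y < e]).
Hypothesis K_compact : forall n, compact (K n).
Hypothesis K_cover : \bigcup_n K n = [set: X].

Let rad (m : nat) : R := m.+1%:R^-1.

(** One number serves as a bound for [i x] relative to [W] and as an inverse radius of continuity at
    [x], so a single sequence over coded pairs (n, k) holds all moduli. *)
Definition controls (W : set L) (k a : nat) (x : X) := W (rad a *: i x) /\
  forall y, d x y < rad a -> W (k.+1%:R *: (i y - i x)).

Definition controlled (a : nat -> nat) (W : set L) :=
  forall n k x, K n x -> controls W k (a (pickle (n, k))) x.

(** The least absolutely convex set controlled by [a]. *)
Definition hull (a : nat -> nat) : set L :=
  [set z | forall W, abs_convex W -> controlled a W -> W z].

Let rad_le m n : (m <= n)%N -> 0 <= rad n <= rad m.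
Proof. by move=> mn; rewrite invr_ge0 ler0n /= lef_pV2 ?posrE// ler_nat. Qed.

Lemma controls_le W k a b x : abs_convex W -> (a <= b)%N ->
  controls W k a x -> controls W k b x.
Proof.
move=> cW ab [ax ay]; have /andP[_ ba] := rad_le ab; split.
  by apply: abs_convex_scale_le ax => //; exact: rad_le.
by move=> y xy; apply: ay; exact: lt_le_trans ba.
Qed.

Lemma hull_mono a b : (forall n, (a n <= b n)%N) -> hull b `<=` hull a.
Proof.
move=> ab z bz W cW aW; apply: bz => // n k x /(aW n k).
exact: controls_le.
Qed.

(** The hull inherits the control by [a], which gives the hypotheses of [free_abs_convex_nbhs]; a
    scalar c is rounded up to k+1 > c. *)
Lemma hull_nbhs a : nbhs (0 : L) (hull a).
Proof.
apply: free_abs_convex_nbhs.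
- split; first by move=> W [].
  by move=> x y s t ax ay st W cW aW; apply: cW.2 => //; [exact: ax|exact: ay].
- move=> x; have [n _ Knx] : (\bigcup_n K n) x by rewrite K_cover.
  exists (rad (a (pickle (n, 0%N)))); first by rewrite invr_gt0.
  by move=> W cW /(_ n 0%N x Knx)[].
- move=> x c c0; have [n _ Knx] : (\bigcup_n K n) x by rewrite K_cover.
  pose k := Num.truncn c; apply/(nbhs_metricP nbhs_d).
  exists (rad (a (pickle (n, k)))); first by rewrite invr_gt0.
  move=> y xy W cW /(_ n k x Knx)[_ /(_ y xy)].
  by apply: abs_convex_scale_le; rewrite // ltW//= ltW// truncnS_gt.
Qed.

(** [x'] and [a] vary jointly, as the covering form of compactness in [hull_small] requires.
    Estimates at [x'] pass through [x] and split in two halves, whence the factors 2. *)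
Lemma controls_near (W : set L) k (x : X) : abs_convex W -> nbhs (0 : L) W ->
  \forall x' \near x & a \near \oo, controls W k a x'.
Proof.
move=> cW W0.
have /(nbhs_metricP nbhs_d)[e e0 eW] := near_scale_diff x (2 * k.+1%:R) W0.
have [t t0 tW] := nbhs0_absorbs (i x) W0.
(* These bounds put 2 [rad m] below 1/t and below 1, and the [rad m]-ball of x' inside the e-ball of
   x. *)
pose r : R := Num.min (Num.min (t^-1 / 2) (2^-1)) (e / 2).
have tV0 : 0 < t^-1 by rewrite invr_gt0.
have r0 : 0 < r by rewrite !lt_min; apply/andP; split; [apply/andP; split|]; lra.
have [m] := ltr_add_invr r0; rewrite add0r -/(rad m) !lt_min => /andP[/andP[mt m1] me].
exists ([set x' | d x x' < e / 2], [set a | (m <= a)%N]).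
  split; last by exists m.
  by apply: (nbhs_metric_ball nbhs_d); rewrite divr_gt0.
move=> [x' a] /= [xx' ma].
have [_ _ dC d_triangle] := d_metric.
apply: (controls_le cW ma); split.
  have -> : rad m *: i x' = rad m *: i x + rad m *: (i x' - i x).
    by rewrite -scalerDr addrC subrK.
  have rad0 : 0 <= rad m by rewrite invr_ge0.
  apply: abs_convex_half; rewrite ?scalerA//.
    by apply: abs_convex_scale_le tW => //; apply/andP; split; lra.
  have ex' : d x x' < e by lra.
  apply: abs_convex_scale_le (eW x' ex') => //.
  have : 1 <= k.+1%:R :> R by rewrite ler1n.
  by move=> k1; apply/andP; split; lra.
move=> y x'y.
have -> : k.+1%:R *: (i y - i x') =
    k.+1%:R *: (i y - i x) + k.+1%:R *: (- (i x' - i x)).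
  by rewrite -scalerDr opprB addrA subrK.
apply: abs_convex_half; rewrite ?scalerA//.
  by apply: eW => /=; have := d_triangle x x' y; lra.
have ex' : d x x' < e by lra.
have := abs_convexZ (s := -1) cW (eW x' ex').
by rewrite normrN normr1 lexx scaleN1r scalerN; apply.
Qed.

(** For an absolutely convex [U] inside [W], compactness of [K n] makes the thresholds of
    [controls_near] uniform for each (n, k). The resulting sequence controls [U], so its hull lies
    in [U]. *)
Lemma hull_small W : nbhs (0 : L) W -> exists a, hull a `<=` W.
Proof.
move=> /nbhs0_abs_convex[U U0 [cU UW]].
have /choice[a Ua] nk : exists a, forall x, K nk.1 x -> controls U nk.2 a x.
  case: nk => n k; have /compact_near_coveringP K_near := @K_compact n.
  have [a _ aU] := K_near nat \oo (controls U k) _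
    (fun x _ => controls_near k x cU U0).
  by exists a; exact: aU (leqnn a).
exists (fun j => if unpickle j is Some nk then a nk else 0%N) => z az.
apply: UW; apply: az => // n k x Knx.
by rewrite pickleK; exact: (Ua (n, k)).
Qed.

Lemma sigma_compact_G_base : has_G_base L.
Proof.
apply: has_G_base_translate; exists hull; last exact: hull_mono.
apply/seteqP; split=> W; first by move=> /hull_small[a aW]; exists a.
by move=> [a _ aW]; apply: filterS aW (hull_nbhs a).
Qed.

End SigmaCompact.

End FreeLocallyConvex.

Theorem corollary1p8 (R : realType) (X : topologicalType) (L : tvsType R)
    (i : X -> L) (hX : metrizable R X) (hL : is_free_lcs i) :
  has_G_base L <-> sigma_compact X.
Proof.
have [d d_metric nbhs_d] := hX; split; last first.
  move=> [K K_compact K_cover].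
  exact: (sigma_compact_G_base hL d_metric nbhs_d K_compact K_cover).
move=> L_G_base; have [_ _ univ] := hL.
have [M M_mono M_cofinal] : exists2 M : (nat -> nat) -> X -> R,
    forall a b, (forall n, (a n <= b n)%N) -> forall x, M a x <= M b x &
    forall f : X -> R, continuous f -> exists a, forall x, `|f x| <= M a x.
  apply: (@G_base_resolution R L X i) => // f f_cont.
  have [g [g_ext _]] := univ R^o f (@norm_hausdorff R R^o) f_cont.
  by exists g.
exact (resolution_sigma_compact d_metric nbhs_d M_mono M_cofinal).
Qed.
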